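(* Let $K$ be a commutative field with $\operatorname{char} K\neq 2$ and let $A$ be an algebra over $K$ obtained by the Cayley-Dickson process. Then for all $x,y,z\in A$, $$(xy-yx)^{2}z=z(xy-yx)^{2}.$$
   Context: Algebras are not assumed associative. For a finite-dimensional unitary algebra $B$ over $K$ with a scalar involution $a\mapsto\overline a$ (a linear map with $\overline{ab}=\overline b\,\overline a$, $\overline{\overline a}=a$, and $a+\overline a,\ a\overline a\in K\cdot 1$ for all $a,b\in B$) and a fixed nonzero $\gamma\in K$, the algebra $(B,\gamma)$ is the vector space $B\oplus B$ with multiplication $(a_1,a_2)(b_1,b_2)=(a_1b_1+\gamma\overline{b_2}a_2,\ a_2\overline{b_1}+b_2a_1)$; it carries the scalar involution $\overline{(a_1,a_2)}=(\overline{a_1},-a_2)$. An algebra obtained by the Cayley-Dickson process is an algebra $A_t=\left(\frac{\alpha_1,\dots,\alpha_t}{K}\right)$, $t\ge 1$, obtained from $K$ (with the identity as involution) by applying this construction $t$ times with nonzero parameters $\alpha_1,\dots,\alpha_t\in K$; it has dimension $2^t$ over $K$. *)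

(* Defs.v *)
From HB Require Import structures.
From mathcomp Require Import all_boot all_order all_algebra.
Set Implicit Arguments.
Unset Strict Implicit.
Unset Printing Implicit Defensive.
Import GRing.Theory.
Local Open Scope ring_scope.

(* Multiplication is not assumed associative or commutative. *)
Record scalar_inv_alg (K : fieldType) := ScalarInvAlg {
  sia_sort :> vectType K;
  sia_one : sia_sort;
  sia_mul : sia_sort -> sia_sort -> sia_sort;
  sia_conj : sia_sort -> sia_sort;
  sia_mul_linearr : forall a, linear (sia_mul a);
  sia_mul_linearl : forall b, linear (fun a => sia_mul a b);
  sia_mul1l : forall a, sia_mul sia_one a = a;
  sia_mul1r : forall a, sia_mul a sia_one = a;
  sia_conj_linear : linear sia_conj;
  sia_conjM : forall a b,
    sia_conj (sia_mul a b) = sia_mul (sia_conj b) (sia_conj a);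
  sia_conjK : forall a, sia_conj (sia_conj a) = a;
  sia_trace : forall a, exists k : K, a + sia_conj a = k *: sia_one;
  sia_norm : forall a, exists k : K, sia_mul a (sia_conj a) = k *: sia_one
}.

Declare Scope sia_scope.
Delimit Scope sia_scope with sia.
Notation "x ** y" := (sia_mul x y) (at level 40, left associativity) : sia_scope.
Local Open Scope sia_scope.

Section Doubling.
Variables (K : fieldType) (B : scalar_inv_alg K).
Implicit Types (a b c : B) (k : K).
Local Notation cj := (@sia_conj K B).
Local Notation e := (sia_one B).

Lemma sia_mulDr a b c : a ** (b + c) = a ** b + a ** c.
Proof. by have := sia_mul_linearr a 1 b c; rewrite !scale1r. Qed.

Lemma sia_mulDl a b c : (a + b) ** c = a ** c + b ** c.
Proof. by have := sia_mul_linearl c 1 a b; rewrite !scale1r. Qed.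

Lemma sia_mulr0 a : a ** 0 = 0.
Proof. by apply: (addrI (a ** 0)); rewrite -sia_mulDr !addr0. Qed.

Lemma sia_mul0l a : 0 ** a = 0.
Proof. by apply: (addrI (0 ** a)); rewrite -sia_mulDl !addr0. Qed.

Lemma sia_mulZr k a b : a ** (k *: b) = k *: (a ** b).
Proof. by have := sia_mul_linearr a k b 0; rewrite sia_mulr0 !addr0. Qed.

Lemma sia_mulZl k a b : (k *: a) ** b = k *: (a ** b).
Proof. by have := sia_mul_linearl b k a 0; rewrite sia_mul0l !addr0. Qed.

Lemma sia_mulNr a b : a ** (- b) = - (a ** b).
Proof. by rewrite -scaleN1r sia_mulZr scaleN1r. Qed.

Lemma sia_mulNl a b : (- a) ** b = - (a ** b).
Proof. by rewrite -scaleN1r sia_mulZl scaleN1r. Qed.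

Lemma sia_conjD a b : cj (a + b) = cj a + cj b.
Proof. by have := @sia_conj_linear K B 1 a b; rewrite !scale1r. Qed.

Lemma sia_conj0 : cj 0 = 0.
Proof. by apply: (addrI (cj 0)); rewrite -sia_conjD !addr0. Qed.

Lemma sia_conjZ k a : cj (k *: a) = k *: cj a.
Proof. by have := @sia_conj_linear K B k a 0; rewrite sia_conj0 !addr0. Qed.

Lemma sia_conjN a : cj (- a) = - cj a.
Proof. by rewrite -scaleN1r sia_conjZ scaleN1r. Qed.

Lemma sia_conj1 : cj e = e.
Proof.
by rewrite -[LHS]sia_mul1l -[X in X ** _ = _]sia_conjK -sia_conjM sia_mul1l sia_conjK.
Qed.

Lemma sia_conj_mulC a : cj a ** a = a ** cj a.
Proof.
have [k ka] := sia_trace a.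
have -> : cj a = k *: e - a by rewrite -ka addrC addKr.
rewrite sia_mulDl sia_mulDr sia_mulNl sia_mulNr sia_mulZl sia_mulZr.
by rewrite sia_mul1l sia_mul1r.
Qed.

Variable gamma : K.

Local Notation BB := (B * B)%type.

Definition cd_one : BB := (e, 0).

Definition cd_mul (x y : BB) : BB :=
  (x.1 ** y.1 + gamma *: (cj y.2 ** x.2), x.2 ** cj y.1 + y.2 ** x.1).

Definition cd_conj (x : BB) : BB := (cj x.1, - x.2).

Fact cd_mul_linearr x : linear (cd_mul x).
Proof.
move=> k [y1 y2] [z1 z2]; rewrite /cd_mul /=; congr (_, _) => /=.
  rewrite sia_mulDr sia_mulZr sia_conjD sia_conjZ sia_mulDl sia_mulZl.
  by rewrite !scalerDr !scalerA (mulrC gamma) addrACA.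
by rewrite sia_conjD sia_conjZ sia_mulDr sia_mulZr sia_mulDl sia_mulZl
           scalerDr addrACA.
Qed.

Fact cd_mul_linearl y : linear (fun x => cd_mul x y).
Proof.
move=> k [x1 x2] [z1 z2]; rewrite /cd_mul /=; congr (_, _) => /=.
  rewrite sia_mulDl sia_mulZl sia_mulDr sia_mulZr.
  by rewrite !scalerDr !scalerA (mulrC gamma) addrACA.
by rewrite sia_mulDl sia_mulZl sia_mulDr sia_mulZr scalerDr addrACA.
Qed.

Fact cd_mul1l x : cd_mul cd_one x = x.
Proof.
case: x => x1 x2; rewrite /cd_mul /= sia_mul1l sia_mulr0 scaler0 addr0.
by rewrite sia_mul0l add0r sia_mul1r.
Qed.

Fact cd_mul1r x : cd_mul x cd_one = x.
Proof.
case: x => x1 x2; rewrite /cd_mul /= sia_mul1r sia_conj0 sia_mul0l scaler0 addr0.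
by rewrite sia_conj1 sia_mul1r sia_mul0l addr0.
Qed.

Fact cd_conj_linear : linear cd_conj.
Proof.
move=> k [x1 x2] [y1 y2]; rewrite /cd_conj /=; congr (_, _) => /=.
  by rewrite sia_conjD sia_conjZ.
by rewrite opprD scalerN.
Qed.

Fact cd_conjM x y : cd_conj (cd_mul x y) = cd_mul (cd_conj y) (cd_conj x).
Proof.
case: x y => [x1 x2] [y1 y2]; rewrite /cd_conj /cd_mul /=; congr (_, _).
  rewrite sia_conjD sia_conjM sia_conjZ sia_conjM sia_conjK.
  by rewrite sia_conjN sia_mulNl sia_mulNr opprK.
by rewrite sia_conjK !sia_mulNl -opprD addrC.
Qed.

Fact cd_conjK x : cd_conj (cd_conj x) = x.
Proof. by case: x => x1 x2; rewrite /cd_conj /= sia_conjK opprK. Qed.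

Fact cd_trace x : exists k, x + cd_conj x = k *: cd_one.
Proof.
case: x => x1 x2; have [k kx] := sia_trace x1; exists k.
by congr (_, _) => /=; rewrite ?kx // subrr scaler0.
Qed.

Fact cd_norm x : exists k, cd_mul x (cd_conj x) = k *: cd_one.
Proof.
case: x => x1 x2; have [k kx] := sia_norm x1; have [l lx] := sia_norm x2.
exists (k - gamma * l); rewrite /cd_mul /cd_conj /=; congr (_, _) => /=.
  rewrite kx sia_conjN sia_mulNl sia_conj_mulC lx.
  by rewrite scalerN scalerA scalerBl.
by rewrite sia_conjK sia_mulNl subrr scaler0.
Qed.

Definition cd_double : scalar_inv_alg K :=
  ScalarInvAlg cd_mul_linearr cd_mul_linearl cd_mul1l cd_mul1r cd_conj_linear
    cd_conjM cd_conjK cd_trace cd_norm.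

End Doubling.

Section Base.
Variable K : fieldType.

Fact cd_base_mul_linearr (a : K^o) : linear (fun b : K^o => a * b : K^o).
Proof. by move=> k b c; rewrite mulrDr /GRing.scale /= mulrCA. Qed.

Fact cd_base_mul_linearl (b : K^o) : linear (fun a : K^o => a * b : K^o).
Proof. by move=> k a c; rewrite mulrDl /GRing.scale /= mulrA. Qed.

Fact cd_base_conj_linear : linear (@id K^o).
Proof. by []. Qed.

Fact cd_base_trace (a : K^o) : exists k : K, a + a = k *: (1 : K^o).
Proof. by exists (a + a); rewrite /GRing.scale /= mulr1. Qed.

Fact cd_base_norm (a : K^o) : exists k : K, a * a = k *: (1 : K^o).
Proof. by exists (a * a); rewrite /GRing.scale /= mulr1. Qed.

Definition cd_base : scalar_inv_alg K :=
  @ScalarInvAlg K K^o 1 (fun a b => a * b) id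
    cd_base_mul_linearr cd_base_mul_linearl (@mul1r K) (@mulr1 K)
    cd_base_conj_linear (fun a b => mulrC a b) (fun=> erefl)
    cd_base_trace cd_base_norm.

End Base.

(* The head of the sequence is the parameter of the first doubling, so that    *)
(* cayley_dickson (rcons s c) = cd_double (cayley_dickson s) c.                *)
Definition cayley_dickson (K : fieldType) (alpha : seq K) : scalar_inv_alg K :=
  foldl (@cd_double K) (cd_base K) alpha.

Lemma dim_cayley_dickson (K : fieldType) (alpha : seq K) :
  \dim {: cayley_dickson alpha} = (2 ^ size alpha)%N.
Proof.
rewrite dimvf; elim/last_ind: alpha => [|s c IHs] //.
by rewrite size_rcons /cayley_dickson foldl_rcons expnS mul2n -addnn -{1}IHs -IHs.
Qed.

(* Main.v *)
(** Replacing [x] and [y] by their conjugates changes each by a sign and a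
scalar, so it leaves the commutator unchanged; since conjugation reverses
products, it sends [c = xy - yx] to [-c].  Hence [c c] is minus the norm of [c],
a scalar multiple of the unit. *)
Require Import Defs.
From mathcomp Require Import all_boot all_order all_algebra.
Import GRing.Theory.
Local Open Scope ring_scope.
Local Open Scope sia_scope.

(** A scalar multiple of the unit commutes with everything, so only the sign of [a] survives. By the
    scalar trace, [sia_conj a] has the form treated here. *)
Lemma sia_commBl (K : fieldType) (B : scalar_inv_alg K) (k : K) (a b : B) :
  (k *: sia_one B - a) ** b - b ** (k *: sia_one B - a) = b ** a - a ** b.
Proof.
rewrite sia_mulDl sia_mulDr sia_mulNl sia_mulNr sia_mulZl sia_mulZr.
by rewrite sia_mul1l sia_mul1r opprB addrC subrKA.
Qed.

Lemma sia_conj_comm (K : fieldType) (B : scalar_inv_alg K) (a b : B) :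
  sia_conj (a ** b - b ** a) = - (a ** b - b ** a).
Proof.
have conjE (c : B) : exists k, sia_conj c = k *: sia_one B - c.
  by have [k kc] := sia_trace c; exists k; rewrite -kc addrC addKr.
have [[s sa] [t tb]] := (conjE a, conjE b).
rewrite sia_conjD sia_conjN !sia_conjM sa tb.
(* Each of the two factors flips the sign once; the flips cancel and only the reversed order
   remains. *)
by rewrite !sia_commBl opprB.
Qed.

Lemma sia_comm_sqr (K : fieldType) (B : scalar_inv_alg K) (a b : B) :
  exists k, (a ** b - b ** a) ** (a ** b - b ** a) = k *: sia_one B.
Proof.
have [k kc] := sia_norm (a ** b - b ** a); exists (- k).
by rewrite scaleNr -kc sia_conj_comm sia_mulNr opprK.
Qed.

Theorem theorem2p3 (K : fieldType) (charK : 2%N \notin [pchar K])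
    (t : nat) (t_gt0 : (0 < t)%N)
    (alpha : t.-tuple K) (alpha_neq0 : forall i : 'I_t, tnth alpha i != 0)
    (x y z : cayley_dickson alpha) :
  ((x ** y - y ** x) ** (x ** y - y ** x)) ** z
  = z ** ((x ** y - y ** x) ** (x ** y - y ** x)).
Proof.
(* With the square a multiple of the unit, bilinearity reduces both sides to [k *: z]. *)
have [k ->] := sia_comm_sqr _ _ x y.
by rewrite sia_mulZl sia_mulZr sia_mul1l sia_mul1r.
Qed.
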